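(* Let $K$ be a field of prime characteristic $p>0$ and let $R=K[x_1,\ldots,x_d]$ be the polynomial ring. Let $I\subseteq J\subseteq R$ be two nonzero proper ideals, with $I$ a monomial ideal and $J$ a radical ideal. Then the $F$-threshold $\mathcal{C}^{J}(I^{\langle\bullet\rangle})$ of the differential power filtration $I^{\langle\bullet\rangle}=\{I^{\langle i\rangle}\}_{i\geq 0}$ with respect to $J$ exists, and $$\mathcal{C}^{J}(I^{\langle\bullet\rangle})\leq \max\{\operatorname{ht}(\mathfrak{p})\;|\;\mathfrak{p}\in\operatorname{Min}(I)\}.$$
   Context: $\mathbb{N}$ includes $0$. Differential operators: the $K$-linear differential operators on $R$ of order at most $n$ are defined inductively by $D_R^0=\operatorname{End}_R(R)=R\subseteq \operatorname{End}_K(R)$ (multiplications by elements of $R$) and, for $n\geq 1$, $D_R^n=\{\delta\in\operatorname{End}_K(R)\;|\;\delta f-f\delta\in D_R^{n-1}\text{ for every } f\in R\}$. For the polynomial ring $R=K[x_1,\ldots,x_d]$, $D_R^n$ is the free $R$-module generated by the divided-power operators $\frac{1}{\alpha_1!}\frac{\partial^{\alpha_1}}{\partial x_1^{\alpha_1}}\cdots\frac{1}{\alpha_d!}\frac{\partial^{\alpha_d}}{\partial x_d^{\alpha_d}}$ with $\alpha_1+\cdots+\alpha_d\leq n$. Differential powers: for an ideal $I\subseteq R$ and $n\geq 1$, $I^{\langle n\rangle}=\{f\in R\;|\;\delta(f)\in I\text{ for all }\delta\in D_R^{n-1}\}$, and $I^{\langle 0\rangle}=R$. Filtrations: a filtration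 of ideals $\mathfrak{a}_\bullet=\{\mathfrak{a}_i\}_{i\geq 0}$ is a sequence of ideals with $\mathfrak{a}_0=R$, $\mathfrak{a}_{i+1}\subseteq\mathfrak{a}_i$ and $\mathfrak{a}_i\mathfrak{a}_j\subseteq\mathfrak{a}_{i+j}$ for all $i,j\geq 0$. In the polynomial ring, the sequence $I^{\langle\bullet\rangle}=\{I^{\langle i\rangle}\}_{i\geq 0}$ is a filtration of ideals. $F$-thresholds: for an ideal $J$, $J^{[p^e]}$ denotes the ideal generated by the $p^e$-th powers of the elements of $J$. For a filtration $\mathfrak{a}_\bullet$ and $e\in\mathbb{N}$, put $\nu_{\mathfrak{a}_\bullet}^J(p^e)=\sup\{t\in\mathbb{N}\;|\;\mathfrak{a}_t\not\subseteq J^{[p^e]}\}$, $\mathcal{C}_+^J(\mathfrak{a}_\bullet)=\limsup_{e\to\infty}\nu_{\mathfrak{a}_\bullet}^J(p^e)/p^e$ and $\mathcal{C}_-^J(\mathfrak{a}_\bullet)=\liminf_{e\to\infty}\nu_{\mathfrak{a}_\bullet}^J(p^e)/p^e$, as elements of $\mathbb{R}_{\geq 0}\cup\{\pm\infty\}$. The $F$-threshold $\mathcal{C}^J(\mathfrak{a}_\bullet)$ exists if $\mathcal{C}_+^J(\mathfrak{a}_\bullet)=\mathcal{C}_-^J(\mathfrak{a}_\bullet)\in\mathbb{R}_{\geq 0}$, and is then this common value. $\operatorname{Min}(I)$ is the set of minimal primes of $I$ and $\operatorname{ht}$ denotes height. A monomial ideal is an ideal generated by monomials in $x_1,\ldots,x_d$.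 *)

(* Defs.v *)
From HB Require Import structures.
From mathcomp Require Import all_boot all_order all_algebra.
From mathcomp Require Import all_classical all_reals all_analysis.
(* The notations of [mpoly] clash with those of the analysis library; its
   canonical instances have to be imported. *)
From mathcomp Require Export (canonicals, coercions) mpoly.

Set Implicit Arguments.
Unset Strict Implicit.
Unset Printing Implicit Defensive.

Import Order.TTheory GRing.Theory Num.Theory.

Local Open Scope classical_set_scope.
Local Open Scope ring_scope.

Notation mpoly := mpoly.mpoly.
Notation multinom := mpoly.multinom.
Notation mpolyX := mpoly.mpolyX.

Section Ideals.
Variable A : comNzRingType.
Implicit Types (I J P Q : set A).

(* Ideals need not be proper or decidable here, unlike in [ring_quotient]. *)
Definition is_ideal I : Prop :=
  [/\ I 0, forall x y, I x -> I y -> I (x + y) & forall a x, I x -> I (a * x)].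

Definition ideal_gen (S : set A) : set A := smallest is_ideal S.

Definition is_proper_ideal I : Prop := is_ideal I /\ I != setT.

Definition is_radical_ideal I : Prop :=
  is_ideal I /\ forall x n, I (x ^+ n) -> I x.

Definition is_prime_ideal P : Prop :=
  is_proper_ideal P /\ forall x y, P (x * y) -> P x \/ P y.

Definition minimal_primes I : set (set A) :=
  [set P | [/\ is_prime_ideal P, I `<=` P &
     forall Q, is_prime_ideal Q -> I `<=` Q -> Q `<=` P -> Q = P]].

(* [c 0 < c 1 < ... < c n = P]; the values of [c] beyond [n] are irrelevant. *)
Definition prime_chain P (n : nat) (c : nat -> set A) : Prop :=
  [/\ forall i, (i <= n)%N -> is_prime_ideal (c i),
      forall i, (i < n)%N -> c i `<` c i.+1 & c n = P].

Definition height (R : realType) P : \bar R :=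
  ereal_sup [set n%:R%:E | n in [set n | exists c, prime_chain P n c]].

Definition frobenius_power J (q : nat) : set A :=
  ideal_gen [set x ^+ q | x in J].

End Ideals.

Section DifferentialPowers.
Variables (K : fieldType) (A : comAlgType K).

Fixpoint diffop (n : nat) : set (A -> A) :=
  if n is m.+1 then
    [set delta | linear delta /\
       forall f, diffop m (fun x => delta (f * x) - f * delta x)]
  else [set delta | exists f, delta = (fun x => f * x)].

Definition diff_power (I : set A) (n : nat) : set A :=
  if n is m.+1 then [set f | forall delta, diffop m delta -> I (delta f)]
  else setT.

End DifferentialPowers.

Definition is_monomial_ideal (K : fieldType) (d : nat) (I : set (mpoly d K)) :=
  exists S : set (multinom d), I = ideal_gen [set mpolyX K m | m in S].

Section FThresholds.
Variables (R : realType) (A : comNzRingType) (p : nat).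
Variables (J : set A) (a : nat -> set A).

Definition F_nu (e : nat) : \bar R :=
  ereal_sup [set t%:R%:E |
    t in [set t | ~ (a t `<=` frobenius_power J (p ^ e))]].

Definition F_nu_ratio (e : nat) : \bar R := (F_nu e * ((p ^ e)%:R^-1)%:E)%E.

Definition upper_F_threshold : \bar R := limn_esup F_nu_ratio.

Definition lower_F_threshold : \bar R := limn_einf F_nu_ratio.

(* The F-threshold exists and equals [c]. *)
Definition is_F_threshold (c : R) : Prop :=
  [/\ 0 <= c, upper_F_threshold = c%:E & lower_F_threshold = c%:E].

End FThresholds.

Definition is_max (R : realType) (S : set (\bar R)) (m : \bar R) : Prop :=
  S m /\ ubound S m.

(* Main.v *)
Require Import Defs.
From mathcomp Require Import all_boot all_order all_algebra.
From mathcomp Require Import all_classical all_reals all_analysis.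
From mathcomp Require Import zify ring.
From mathcomp Require Import -(notations) ssrcomplements mpoly.

(** Write nu(q) for the largest t such that the differential power I^<t> is
    not contained in J^[q], where q = p^e.  The threshold exists because
    nu(q)/q is nondecreasing in e and bounded; the bound also bounds the limit.

    Differential powers of a monomial ideal are governed by monomials: the
    divided-power operator of multi-index a sends x^m to binom(m, a) x^(m - a),
    so if f is in I^<t>, if x^m occurs in f, if |a| < t and if binom(m, a) is
    nonzero in K, then x^(m - a) is in I ([diff_power_mono]).

    Upper bound.  Let h be the largest number of variables generating a
    minimal prime of I; it is at most the largest height, since a prime
    generated by n variables is the top of an explicit chain of length n.  If
    t > h(q - 1) then I^<t> is contained in J^[q]
    ([diff_power_sub_frobenius]).  Indeed, let x^m occur in an element of I^<t>
    and let u = floor(m / q).  If x^u is in J, then x^m is a multiple of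
    (x^u)^q.  Otherwise, J being radical, every monomial of I involves a
    variable outside the support of u, so I has a minimal prime P generated by
    such variables.  These have exponent at most q - 1 in m, so the part a of m
    in the variables of P has degree at most h(q - 1) < t, and binom(m, a) = 1.
    Hence x^(m - a) is in I, hence in P, although it involves no variable
    of P.

    Monotonicity.  If I^<t> is not contained in J^[q], some x^m occurring in an
    element of I^<t> is outside J^[q].  Then x^(pm) is in I^<pt>
    ([diff_power_frobenius]), because commutation with x_i^p is the p-fold
    iterate of commutation with x_i and so lowers the order of an operator by
    p: a Taylor expansion in the x_i^p only produces terms
    binom(m, b) x^(p(m - b)) with p|b| < pt.  And x^(pm) is outside J^[pq],
    since f^p in L^[p] forces f in L for every ideal L
    ([frobenius_power_reflect]).  So nu(pq) >= p nu(q). *)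

Set Implicit Arguments.
Unset Strict Implicit.
Unset Printing Implicit Defensive.

Import Order.TTheory GRing.Theory Num.Theory numFieldNormedType.Exports.

Local Open Scope classical_set_scope.
Local Open Scope ring_scope.

(** * Differential operators *)

Section Commutators.
Variable A : comNzRingType.
Implicit Types (f : A) (D E : A -> A).

Definition commutator f D : A -> A := fun x => D (f * x) - f * D x.

Lemma commutatorE D f x : D (f * x) = f * D x + commutator f D x.
Proof. by rewrite /commutator addrC subrK. Qed.

(** Left multiplication by [f] commutes with [commutator f], and their sum
    precomposes an operator with multiplication by [f]: this is the binomial
    theorem for that sum. *)
Lemma iter_commutator_binomial D f k x :
  D (f ^+ k * x) =
  \sum_(j < k.+1) (f ^+ (k - j) * iter j (commutator f) D x) *+ 'C(k, j).
Proof.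
have iterC i E : commutator f (iter i (commutator f) E) =
    iter i (commutator f) (commutator f E) by rewrite -iterSr.
elim: k D x => [|k IHk] D x.
  by rewrite big_ord_recl big_ord0 /= !expr0 !mul1r addr0 bin0.
rewrite exprS -mulrA commutatorE !IHk mulr_sumr.
rewrite big_ord_recl [RHS]big_ord_recl /= !subn0 !bin0 !mulr1n mulrA -exprS.
rewrite -addrA; congr (_ + _).
under [RHS]eq_bigr => i _ do rewrite /bump /= add1n subSS binS mulrnDr iterC.
rewrite big_split /=; congr (_ + _).
rewrite [RHS]big_ord_recr /= bin_small // mulr0n addr0.
apply: eq_bigr => i _; rewrite /bump /= add1n.
rewrite iterC mulrnAr mulrA -exprS; congr (_ * _ *+ _).
by congr (f ^+ _); have := ltn_ord i; lia.
Qed.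

End Commutators.

Section DifferentialOperators.
Variables (K : fieldType) (A : comAlgType K).
Implicit Types (f g c : A) (n p : nat) (D E : A -> A).

(** The inner binomial coefficients in the expansion of [D (f ^+ p * x)] vanish.
    Commuting with [f ^+ p] therefore lowers the order of a differential
    operator by [p] instead of by 1. *)
Lemma commutator_exp p D f : p \in [pchar K] ->
  commutator (f ^+ p) D = iter p (commutator f) D.
Proof.
move=> hp; have p_prime := pcharf_prime hp.
case: p hp p_prime => // p hp p_prime.
apply: funext => x; apply: (addrI (f ^+ p.+1 * D x)).
rewrite -commutatorE iter_commutator_binomial big_ord_recr big_ord_recl /=.
rewrite subn0 bin0 subnn binn !mulr1n expr0 mul1r big1 ?addr0 // => i _.
set j := bump 0 i; have /dvdnP [k ->] : (p.+1 %| 'C(p.+1, j))%N.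
  by apply: prime_dvd_bin => //; rewrite /j /bump /=; have := ltn_ord i; lia.
by rewrite mulrnA -scaler_nat (pcharf0 hp) scale0r.
Qed.

Lemma diffop_linear n D : diffop n D -> linear D.
Proof.
case: n => [[f ->] a x y|n []//].
by rewrite mulrDr -scalerAr.
Qed.

Lemma diffop_subset n D : diffop n D -> diffop n.+1 D.
Proof.
elim: n D => [|n IHn] D.
  move=> hD; split; first exact: diffop_linear hD.
  case: hD => f -> g; exists 0; apply: funext => x.
  by rewrite mul0r mulrCA subrr.
by move=> [linD hD]; split=> // f; apply: IHn; apply: hD.
Qed.

Lemma diffop_le m n D : (m <= n)%N -> diffop m D -> diffop n D.
Proof.
move=> /subnK <-; elim: (n - m)%N => //= k IHk /IHk.
exact: diffop_subset.
Qed.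

Lemma diffopD n D E : diffop n D -> diffop n E ->
  diffop n (fun x => D x + E x).
Proof.
elim: n D E => [|n IHn] D E.
  move=> [f ->] [g ->]; exists (f + g); apply: funext => x.
  by rewrite mulrDl.
move=> [linD hD] [linE hE]; split=> [a x y|f].
  by rewrite linD linE scalerDr addrACA.
have := IHn _ _ (hD f) (hE f); congr (diffop n _).
by apply: funext => x; ring.
Qed.

Lemma diffopMl n D f : diffop n D -> diffop n (fun x => f * D x).
Proof.
elim: n D => [|n IHn] D.
  move=> [g ->]; exists (f * g); apply: funext => x.
  by rewrite mulrA.
move=> [linD hD]; split=> [a x y|g].
  by rewrite linD mulrDr -scalerAr.
have := IHn _ (hD g); congr (diffop n _).
by apply: funext => x; ring.
Qed.

Lemma diffopMr n D f : diffop n D -> diffop n (fun x => D (f * x)).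
Proof.
elim: n D => [|n IHn] D.
  move=> [g ->]; exists (g * f); apply: funext => x.
  by rewrite mulrA.
move=> [linD hD]; split=> [a x y|g].
  by rewrite mulrDr -scalerAr linD.
have := IHn _ (hD g); congr (diffop n _).
by apply: funext => x; rewrite mulrCA.
Qed.

(** [diffop n] is an order at most [n]; the strict version allows the zero
    operators as those of order below 0, so that commutators always lower the
    order, and it matches the shift in the definition of [diff_power]. *)
Definition diffop_lt n : set (A -> A) :=
  if n is m.+1 then diffop m else [set fun=> 0].

Lemma diffop_lt_commutator n D f :
  diffop_lt n D -> diffop_lt n.-1 (commutator f D).
Proof.
case: n => [->|[|n]] /=.
- by apply: funext => x; rewrite /commutator mulr0 subrr.
- by case=> g ->; apply: funext => x; rewrite /commutator mulrCA subrr.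
- by move=> [_ hD]; apply: hD.
Qed.

Lemma diffop_lt_iter_commutator n D f k :
  diffop_lt n D -> diffop_lt (n - k) (iter k (commutator f) D).
Proof.
move=> hD; elim: k => [|k IHk]; first by rewrite subn0.
by rewrite subnS iterS; apply: diffop_lt_commutator.
Qed.

Lemma diff_powerP (I : set A) n f : is_ideal I ->
  diff_power I n f <-> forall D, diffop_lt n D -> I (D f).
Proof.
case: n => // -[I0 _ _]; split=> // _ D ->.
exact: I0.
Qed.

End DifferentialOperators.

(** * Divided-power operators *)

Section MultiBinomials.
Variable d : nat.
Implicit Types (m a s : multinom d) (i : 'I_d).

Definition multibin m a : nat := (\prod_i 'C(m i, a i))%N.

Lemma multibin0 m : multibin m (@mnm0 d) = 1%N.
Proof. by rewrite /multibin big1 // => i _; rewrite mnm0E bin0. Qed.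

Lemma multibin_le m a : multibin m a != 0%N -> forall i, (a i <= m i)%N.
Proof.
move=> nz i; rewrite leqNgt; apply: contra nz => lt_mi.
by rewrite /multibin (bigD1 i) //= bin_small.
Qed.

(** The next two lemmas make the commutator of a divided-power operator with a
    variable computable on monomials; the second is Pascal's rule. *)
Lemma multibinU0 m a i : a i = 0%N ->
  multibin (mnm_add (mnm1 i) m) a = multibin m a.
Proof.
move=> ai0; apply: eq_bigr => j _; rewrite mnmDE mnm1E.
by case: eqVneq => [<-|//]; rewrite ai0 !bin0.
Qed.

Lemma multibinUS m a i : a i != 0%N ->
  multibin (mnm_add (mnm1 i) m) a =
  (multibin m a + multibin m (mnm_sub a (mnm1 i)))%N.
Proof.
move=> ai_nz; rewrite /multibin !(bigD1 (P := predT) i) //=.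
rewrite mnmDE mnmBE mnm1E eqxx add1n; case: (a i) ai_nz => // k _.
rewrite binS subn1 /= mulnDl; congr (_ * _ + _ * _)%N.
  apply: eq_bigr => j ne_ji.
  by rewrite mnmDE mnm1E eq_sym (negbTE ne_ji).
apply: eq_bigr => j ne_ji.
by rewrite mnmDE mnmBE mnm1E eq_sym (negbTE ne_ji) subn0.
Qed.

End MultiBinomials.

Section Hasse.
Variables (K : fieldType) (d : nat).
Local Notation R := (mpoly d K).
Local Notation X := (mpolyX K).
Implicit Types (m a s : multinom d) (i : 'I_d) (f g : R).

Definition mono_linear (V : lmodType K) (u : multinom d -> V) f : V :=
  \sum_(m <- msupp f) mcoeff m f *: u m.

(** Summing over a fixed finite set of monomials, independent of [f], makes
    linearity visible. *)
Lemma mono_linearE (V : lmodType K) (u : multinom d -> V) f k :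
  (mmeasure mdeg f <= k)%N ->
  mono_linear u f =
  \sum_(m : bmultinom d k) mcoeff (bmnm m) f *: u (bmnm m).
Proof.
move=> le_fk; rewrite /mono_linear.
pose I : subFinType _ := bmultinom d k.
rewrite (big_mksub I) ?msupp_uniq //=; last first.
  by move=> x /msize_mdeg_lt /leq_trans; apply.
rewrite big_rmcond //= => m /memN_msupp_eq0 ->.
by rewrite scale0r.
Qed.

Lemma mono_linear_linear (V : lmodType K) (u : multinom d -> V) :
  linear (mono_linear u).
Proof.
move=> c f g.
pose k := maxn (mmeasure mdeg (c *: f + g))
  (maxn (mmeasure mdeg f) (mmeasure mdeg g)).
rewrite !(@mono_linearE _ _ _ k) ?leq_max ?leqnn ?orbT //.
rewrite scaler_sumr -big_split /=; apply: eq_bigr => m _.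
by rewrite mcoeffD mcoeffZ scalerDl scalerA.
Qed.

Lemma mono_linearX (V : lmodType K) (u : multinom d -> V) m :
  mono_linear u (X m) = u m.
Proof.
by rewrite /mono_linear msuppX big_seq1 mcoeffX eqxx scale1r.
Qed.

Lemma linear_fun0 (U V : lmodType K) (D : U -> V) : linear D -> D 0 = 0.
Proof.
by move=> linD; have := linD (-1) 0 0; rewrite scaler0 addr0 scaleN1r addNr.
Qed.

Lemma linear_mono_ext (V : lmodType K) (D E : R -> V) :
  linear D -> linear E -> (forall m, D (X m) = E (X m)) -> D = E.
Proof.
move=> linD linE eqDE; apply: funext; elim/mpolyind => [|c m f _ _ IHf].
  by rewrite (linear_fun0 linD) (linear_fun0 linE).
by rewrite linD linE eqDE IHf.
Qed.

Lemma diffop_const n (c : R) : diffop n (fun x => c * x).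
Proof. by apply: (@diffop_le _ _ 0) => //; exists c. Qed.

Lemma commutator_linear (D : R -> R) f :
  linear D -> linear (commutator f D).
Proof.
move=> linD a x y; rewrite /commutator mulrDr -scalerAr !linD.
by rewrite mulrDr -scalerAr scalerBr opprD addrACA.
Qed.

(** The elements whose commutator with [D] has order at most [n] form a
    subalgebra, because [D, fg] = [D, f] g + f [D, g]; hence the variables are
    enough to test the order. *)
Lemma diffop_vars n (D : R -> R) : linear D ->
  (forall i, diffop n (commutator (X (mnm1 i)) D)) -> diffop n.+1 D.
Proof.
move=> linD hX; split=> //.
have h0 : diffop n (fun _ : R => 0).
  have := @diffop_const n 0; congr (diffop n _).
  by apply: funext => x; rewrite mul0r.
have h1 : diffop n (commutator 1 D).
  have := h0; congr (diffop n _).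
  by apply: funext => x; rewrite /commutator !mul1r subrr.
have hM f g : diffop n (commutator f D) -> diffop n (commutator g D) ->
    diffop n (commutator (f * g) D).
  move=> hf hg; have := diffopD (diffopMr g hf) (diffopMl f hg).
  congr (diffop n _); apply: funext => x.
  by rewrite /commutator -[f * g * x]mulrA; ring.
elim/mpolyind => [|c m f _ _ IHf].
  have := h0; congr (diffop n _); apply: funext => x.
  by rewrite !mul0r (linear_fun0 linD) subr0.
have hm : diffop n (commutator (X m) D).
  rewrite mpolyXE_id; apply: (big_ind (fun f => diffop n (commutator f D))) => //.
  by move=> i _; elim: (m i) => [//|k IHk]; rewrite exprS; apply: hM.
have := diffopD (diffopMl (mpolyC d c) hm) IHf.
congr (diffop n _); apply: funext => x; rewrite /commutator mul_mpolyC.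
by rewrite mulrDl -scalerAl linD scalerBr mulrDl -scalerAl opprD addrACA.
Qed.

(** The divided-power operator, the product over [i] of the
    d^(a i) / dx_i^(a i) divided by (a i)!, in a form that makes sense in
    positive characteristic. *)
Definition hasse a : R -> R :=
  mono_linear (fun m => (multibin m a)%:R *: X (mnm_sub m a)).

Lemma commutator_hasse0 a i : a i = 0%N ->
  commutator (X (mnm1 i)) (hasse a) = fun=> 0.
Proof.
move=> ai0; apply: linear_mono_ext => [||m].
- exact/commutator_linear/mono_linear_linear.
- by move=> c x y; rewrite scaler0 addr0.
rewrite /commutator -mpolyXD /hasse !mono_linearX multibinU0 //.
have [->|nz] := eqVneq (multibin m a) 0%N.
  by rewrite !scale0r mulr0 subr0.
rewrite -scalerAr -mpolyXD; apply/eqP; rewrite subr_eq0; apply/eqP.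
congr (_ *: X _); apply/mnmP => j; rewrite !mnmBE !mnmDE mnmBE.
by rewrite addnBA // multibin_le.
Qed.

Lemma commutator_hasseS a i : a i != 0%N ->
  commutator (X (mnm1 i)) (hasse a) = hasse (mnm_sub a (mnm1 i)).
Proof.
move=> ai_nz; apply: linear_mono_ext => [||m].
- exact/commutator_linear/mono_linear_linear.
- exact: mono_linear_linear.
rewrite /commutator -mpolyXD /hasse !mono_linearX multibinUS //.
rewrite natrD scalerDl.
have -> : mnm_sub m (mnm_sub a (mnm1 i)) =
    mnm_sub (mnm_add (mnm1 i) m) a.
  apply/mnmP => j; rewrite !mnmBE mnmDE mnm1E.
  by case: eqVneq => [<-|_]; [move: ai_nz; lia | lia].
rewrite addrAC -[RHS]add0r; congr (_ + _).
have [->|nz] := eqVneq (multibin m a) 0%N.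
  by rewrite !scale0r mulr0 subr0.
rewrite -scalerAr -mpolyXD; apply/eqP; rewrite subr_eq0; apply/eqP.
congr (_ *: X _); apply/mnmP => j; rewrite !mnmBE !mnmDE mnmBE.
by rewrite addnBA // multibin_le.
Qed.

(** Commuting with [x_i] turns the operator of index [a] into that of index
    [a - e_i], or kills it. *)
Lemma diffop_hasse a n : (mdeg a <= n)%N -> diffop n (hasse a).
Proof.
elim: n a => [|n IHn] a le_an.
  move: le_an; rewrite leqn0 mdeg_eq0 => /eqP ->; exists 1.
  apply: linear_mono_ext => [||m]; first exact: mono_linear_linear.
    by move=> c x y; rewrite !mul1r.
  by rewrite /hasse mono_linearX multibin0 scale1r subm0 mul1r.
apply: diffop_vars => [|i]; first exact: mono_linear_linear.
have [ai0|ai_nz] := eqVneq (a i) 0%N.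
  rewrite commutator_hasse0 //; have := @diffop_const n 0.
  by congr (diffop n _); apply: funext => x; rewrite mul0r.
rewrite commutator_hasseS //; apply: IHn.
have := mdegD (mnm_sub a (mnm1 i)) (mnm1 i).
rewrite submK ?lep1mP // mdeg1; lia.
Qed.

Lemma mcoeff_hasse a m f :
  mcoeff m (hasse a f) =
  (multibin (mnm_add m a) a)%:R * mcoeff (mnm_add m a) f.
Proof.
pose c : R -> K := mcoeff m \o hasse a.
pose e : R -> K^o := fun f =>
  (multibin (mnm_add m a) a)%:R * mcoeff (mnm_add m a) f.
suff /(congr1 (fun u => u f)) : (c : R -> K^o) = e by [].
apply: linear_mono_ext => [b x y|b x y|m'].
- by rewrite /c /= /hasse mono_linear_linear mcoeffD mcoeffZ.
- rewrite /e mcoeffD mcoeffZ mulrDr; congr (_ + _).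
  by rewrite mulrCA.
rewrite /c /e /= /hasse mono_linearX mcoeffZ !mcoeffX.
have [eq_m|ne_m] := eqVneq m' (mnm_add m a).
  by rewrite eq_m addmK eqxx.
have [->|nz] := eqVneq (multibin m' a) 0%N; first by rewrite !mul0r mulr0.
case: eqP => [eq_m|_]; last by rewrite !mulr0.
case/eqP: ne_m; rewrite -eq_m submK //.
by apply/mnm_lepP; apply: multibin_le.
Qed.

End Hasse.

(** * Differential powers of monomial ideals *)

Section IdealBasics.
Variable A : comNzRingType.
Implicit Types (S I J : set A).

Lemma ideal_gen_ideal S : is_ideal (ideal_gen S).
Proof.
split=> [|x y hx hy|a x hx] I [idI SI]; have [I0 ID IM] := idI.
- exact: I0.
- by apply: ID; [apply: hx|apply: hy].
- by apply: IM; apply: hx.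
Qed.

Lemma ideal_gen_sub S : S `<=` ideal_gen S.
Proof. by move=> x Sx I [_]; apply. Qed.

Lemma ideal_gen_min S I : is_ideal I -> S `<=` I -> ideal_gen S `<=` I.
Proof. by move=> idI SI x; apply. Qed.

Lemma ideal_sum I (T : Type) (r : seq T) (F : T -> A) :
  is_ideal I -> (forall i, I (F i)) -> I (\sum_(i <- r) F i).
Proof. by case=> I0 ID _ hF; apply: big_ind. Qed.

Lemma ideal_sum_seq I (T : eqType) (r : seq T) (F : T -> A) :
  is_ideal I -> {in r, forall i, I (F i)} -> I (\sum_(i <- r) F i).
Proof.
by case=> I0 ID _ hF; rewrite big_seq; apply: big_ind.
Qed.

Lemma ideal1 I : is_ideal I -> I 1 -> I = setT.
Proof.
case=> _ _ IM I1; apply/seteqP; split=> // x _.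
by rewrite -[x]mulr1; apply: IM.
Qed.

Lemma prime_idealX I x k : is_prime_ideal I -> I (x ^+ k) -> I x.
Proof.
case=> -[idI I_proper] primeI; elim: k => [|k IHk].
  by rewrite expr0 => /(ideal1 idI) eqI; rewrite eqI eqxx in I_proper.
by rewrite exprS => /primeI [].
Qed.

End IdealBasics.

Section MonomialIdeals.
Variables (K : fieldType) (d : nat).
Local Notation R := (mpoly d K).
Local Notation X := (mpolyX K).
Implicit Types (m a s : multinom d) (i : 'I_d) (f g : R) (I J : set R).

Lemma mem_mono_ideal I f : is_ideal I ->
  {in msupp f, forall m, I (X m)} -> I f.
Proof.
move=> idI hf; rewrite [f]mpolyE; apply: ideal_sum_seq => // m /hf.
by case: idI => _ _ IM hm; rewrite -mul_mpolyC; apply: IM.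
Qed.

Lemma mono_mul_le I m s : is_ideal I -> I (X s) ->
  (forall i, (s i <= m i)%N) -> I (X m).
Proof.
move=> [_ _ IM] Is le_sm; rewrite -(@submK _ s m); last exact/mnm_lepP.
by rewrite mpolyXD; apply: IM.
Qed.

(** The polynomials all of whose monomials lie in [I] form an ideal, which
    contains the monomial generators of [I]. *)
Lemma monomial_ideal_msupp I f m : is_monomial_ideal I ->
  I f -> m \in msupp f -> I (X m).
Proof.
case=> S ->; set I' := ideal_gen _ => If.
have idI' : is_ideal I' by apply: ideal_gen_ideal.
move: m; apply: (If [set f | forall m, m \in msupp f -> I' (X m)]); split.
  split=> [m|x y hx hy m|a x hx m].
  - by rewrite msupp0.
  - by move=> /msuppD_le; rewrite mem_cat => /orP [/hx|/hy].
  - move=> /msuppM_le /allpairsP [[m1 m2] /= [_ /hx h ->]].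
    by case: idI' => _ _ IM; rewrite mpolyXD; apply: IM.
move=> _ [s Ss <-] m; rewrite msuppX inE => /eqP ->.
by apply: ideal_gen_sub; exists s.
Qed.

(** Distinct monomials [x^m] with nonzero [multibin m a] have distinct images
    under [hasse a] up to scalars, so [x^(m - a)] does not cancel in
    [hasse a f]. *)
Lemma diff_power_mono I t f a m : is_monomial_ideal I ->
  diff_power I t f -> m \in msupp f -> (mdeg a < t)%N ->
  (multibin m a)%:R != 0 :> K -> I (X (mnm_sub m a)).
Proof.
move=> monI hf m_f lt_at bin_nz.
have If : I (hasse a f).
  by case: t lt_at hf => // t lt_at; apply; apply: diffop_hasse.
apply: (monomial_ideal_msupp monI If); rewrite mcoeff_msupp mcoeff_hasse.
rewrite submK ?mulf_neq0 -?mcoeff_msupp //; apply/mnm_lepP.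
by apply: multibin_le; apply: contraNneq bin_nz => ->.
Qed.

End MonomialIdeals.

Section FrobeniusOfDifferentialPowers.
Variables (K : fieldType) (p : nat).
Hypothesis hp : p \in [pchar K].

(** Taylor expansion of [D] in the powers [x i ^+ p], one element at a time:
    the term of index [b] carries a commutator of order below [n - p |b|], which
    is zero unless [p |b| < n].  The factor [c] collects the powers already
    expanded.  Only membership in [I] is recorded, so the sum over [b] need
    not be written down. *)
Lemma diffop_pow_expand (A : comAlgType K) (I : set A) (T : finType)
    (x : T -> A) (e : T -> nat) (r : seq T) (c : A) n (D : A -> A) :
  is_ideal I -> uniq r -> diffop_lt n D ->
  (forall b : T -> nat, (forall i, i \notin r -> b i = 0%N) ->
     (p * \sum_i b i < n)%N -> (\prod_(i <- r) 'C(e i, b i))%:R != 0 :> K ->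
     I (c * \prod_(i <- r) x i ^+ (p * (e i - b i)))) ->
  I (c * D (\prod_(i <- r) x i ^+ (p * e i))).
Proof.
move=> idI; have [I0 ID IM] := idI.
elim: r c n D => [|i r IHr] c n D /=.
  move=> _ hD hI; rewrite big_nil; case: n hD hI => [->|n hD] hI.
    by rewrite mulr0.
  rewrite mulrC; apply: IM; have := hI (fun=> 0%N) _ _ _.
  rewrite !big_nil mulr1 big1 ?muln0 ?oner_eq0 //; exact.
move=> /andP [i_r uniq_r] hD hI.
rewrite big_cons exprM iter_commutator_binomial mulr_sumr.
apply: ideal_sum => // j.
have [bin0K|bin_nz] := eqVneq ('C(e i, j)%:R : K) 0.
  by rewrite -scaler_nat bin0K scale0r mulr0.
rewrite -mulr_natl mulrCA; apply: (IM); rewrite mulrA.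
have hDj : diffop_lt (n - p * j) (iter j (commutator (x i ^+ p)) D).
  have -> : iter j (commutator (x i ^+ p)) D =
      iter (p * j) (commutator (x i)) D.
    elim: (j : nat) => [|k IHk]; first by rewrite muln0.
    by rewrite iterS IHk (commutator_exp _ _ hp) mulnS iterD.
  exact: diffop_lt_iter_commutator.
apply: IHr hDj _ => // b b0 lt_b binb_nz.
(* [b] extended by the index [j] of the current term at [i]. *)
pose b' k := if k == i then (j : nat) else b k.
have b'r k : k \in r -> b' k = b k.
  by rewrite /b'; case: eqP => // -> /(negP i_r).
have -> : c * (x i ^+ p) ^+ (e i - j) =
    c * x i ^+ (p * (e i - b' i)) by rewrite /b' eqxx exprM.
rewrite -mulrA.
have -> : \prod_(k <- r) x k ^+ (p * (e k - b k)) =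
    \prod_(k <- r) x k ^+ (p * (e k - b' k)).
  by apply: eq_big_seq => k /b'r ->.
suff h : I (c * \prod_(k <- i :: r) x k ^+ (p * (e k - b' k))).
  by rewrite big_cons in h.
apply: hI.
- move=> k; rewrite inE negb_or /b' => /andP [/negbTE -> /b0].
  by [].
- have -> : (\sum_k b' k = j + \sum_k b k)%N.
    rewrite (bigD1 i) // [in RHS](bigD1 i) //= /b' eqxx b0 // add0n.
    by congr (_ + _)%N; apply: eq_bigr => k /negbTE ->.
  by rewrite mulnDr; lia.
- rewrite big_cons natrM mulf_neq0 //; first by rewrite /b' eqxx.
  by rewrite (eq_big_seq (fun k => 'C(e k, b k))) // => k /b'r ->.
Qed.

Variable d : nat.
Local Notation R := (mpoly d K).
Local Notation X := (mpolyX K).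

Lemma diff_power_frobenius (I : set R) t f m :
  is_ideal I -> is_monomial_ideal I ->
  diff_power I t f -> m \in msupp f ->
  diff_power I (p * t) (X (mnm_muln m p)).
Proof.
move=> idI monI hf m_f; apply/(diff_powerP _ _ idI) => D hD.
have -> : X (mnm_muln m p) =
    \prod_(i <- index_enum 'I_d) X (mnm1 i) ^+ (p * m i).
  by rewrite mpolyXE_id; apply: eq_bigr => i _; rewrite mulmnE mulnC.
rewrite -[D _]mul1r; apply: (diffop_pow_expand idI _ hD).
  exact: index_enum_uniq.
move=> b _ lt_b bin_nz; rewrite mul1r.
pose a : multinom d := Multinom [tuple b i | i < d].
have aE i : a i = b i by rewrite mnmE.
have binE : (\prod_(i <- index_enum 'I_d) 'C(m i, b i))%N = multibin m a.
  by apply: eq_bigr => i _; rewrite aE.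
rewrite binE in bin_nz.
have lt_at : (mdeg a < t)%N.
  rewrite mdegE (eq_bigr b) => [|i _]; last exact: aE.
  by move: lt_b; rewrite ltn_mul2l => /andP [].
have := diff_power_mono monI hf m_f lt_at bin_nz.
rewrite mpolyXE_id => hI.
under eq_bigr => i _ do rewrite mulnC exprM -aE -mnmBE.
have p_gt0 := prime_gt0 (pcharf_prime hp).
rewrite prodrXl -(prednK p_gt0) exprSr.
by case: idI => _ _; apply.
Qed.
End FrobeniusOfDifferentialPowers.

(** * Descent along Frobenius *)

Section FrobeniusDescent.
Variables (K : fieldType) (d : nat).
Local Notation R := (mpoly d K).
Local Notation X := (mpolyX K).
Implicit Types (m : multinom d) (f g h : R) (I J : set R) (s : seq (K * R)).

(** The ideal generated by the image of [I] under [F] acting on coefficients;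
    since [I] is an ideal, linear combinations over [K] suffice. *)
Definition extended_span (F : {rmorphism K -> K}) I : set R :=
  [set h | exists2 s, {in s, forall x, I x.2} &
                      h = \sum_(x <- s) x.1 *: map_mpoly F x.2].

Lemma extended_span_ideal (F : {rmorphism K -> K}) I :
  is_ideal I -> is_ideal (extended_span F I).
Proof.
move=> [I0 ID IM]; have addW g h : extended_span F I g ->
    extended_span F I h -> extended_span F I (g + h).
  move=> [s hs ->] [s' hs' ->]; exists (s ++ s'); last by rewrite big_cat.
  by move=> x; rewrite mem_cat => /orP [/hs|/hs'].
have zeroW : extended_span F I 0 by exists [::]; rewrite ?big_nil.
split=> // a h [s hs ->]; rewrite [a]mpolyE mulr_suml.
apply: big_ind => // m _.
exists [seq (mcoeff m a * x.1, X m * x.2) | x <- s].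
  by move=> _ /mapP [x /hs hx ->] /=; apply: IM.
rewrite big_map mulr_sumr; apply: eq_bigr => x _ /=.
rewrite rmorphM /= map_mpolyX.
by rewrite -scalerAl -scalerAr scalerA.
Qed.

(** A linear system with coefficients in the subfield [F K] that is solvable
    over [K] is solvable over [F K], and the solution pulls back along [F]. *)
Lemma extended_span_descent (F : {rmorphism K -> K}) I f :
  is_ideal I -> extended_span F I (map_mpoly F f) -> I f.
Proof.
move=> idI [s hs eq_f].
(* Below degree [k] lie all the monomials of [f] and of the [b i]. *)
pose x0 : K * R := (0, 0).
pose b (i : 'I_(size s)) : R := (nth x0 s i).2.
pose k := maxn (mmeasure mdeg f) (\max_i mmeasure mdeg (b i)).
pose mon (j : 'I_#|{: bmultinom d k}|) : multinom d := bmnm (enum_val j).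
pose v : 'rV[K]_#|{: bmultinom d k}| := \row_j mcoeff (mon j) f.
pose B : 'M[K]_(size s, #|{: bmultinom d k}|) :=
  \matrix_(i, j) mcoeff (mon j) (b i).
have : (map_mx F v <= map_mx F B)%MS.
  apply/submxP; exists (\row_i (nth x0 s i).1); apply/rowP => j.
  rewrite !mxE -mcoeff_map_mpoly eq_f (big_nth x0) big_mkord raddf_sum /=.
  by apply: eq_bigr => i _; rewrite !mxE mcoeffZ mcoeff_map_mpoly.
rewrite map_submx => /submxP [D eq_v].
have -> : f = \sum_i D 0 i *: b i.
  apply/mpolyP => m; rewrite raddf_sum /=.
  have [lt_mk|le_km] := ltnP (mdeg m) k.
    pose j := enum_rank (BMultinom lt_mk).
    have mon_j : mon j = m by rewrite /mon enum_rankK.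
    have /rowP /(_ j) := eq_v; rewrite !mxE mon_j => ->.
    by apply: eq_bigr => i _; rewrite !mxE mcoeffZ mon_j.
  have coef0 g : (mmeasure mdeg g <= k)%N -> mcoeff m g = 0.
    move=> le_gk; apply/eqP; rewrite mcoeff_eq0.
    by apply: msize_mdeg_ge; apply: leq_trans le_km.
  rewrite coef0 ?leq_maxl // big1 // => i _; rewrite mcoeffZ coef0 ?mulr0 //.
  by rewrite leq_max (leq_bigmax i) orbT.
apply: ideal_sum => // i; have [_ _ IM] := idI.
by rewrite -mul_mpolyC; apply: IM; apply: hs; apply: mem_nth.
Qed.

Variable p : nat.

(** The projection of [R] onto the monomials in the [x_i ^+ p], followed by
    [x_i ^+ p] |-> [x_i].  Coefficients are left alone, because [K] may be
    imperfect. *)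
Definition exponent_root : R -> R :=
  mono_linear (fun m => if [forall i, (p %| m i)%N]
    then X (Multinom [tuple (m i %/ p)%N | i < d]) else 0).

Lemma exponent_root_linear : linear exponent_root.
Proof. exact: mono_linear_linear. Qed.

Lemma exponent_rootMX g m : (0 < p)%N ->
  exponent_root (g * X (mnm_muln m p)) = exponent_root g * X m.
Proof.
move=> p_gt0; have linr := exponent_root_linear.
pose D g := exponent_root (g * X (mnm_muln m p)).
pose E g := exponent_root g * X m.
suff /(congr1 (fun u => u g)) : D = E by [].
apply: linear_mono_ext => [a x y|a x y|u]; rewrite /D /E.
- by rewrite mulrDl -scalerAl linr.
- by rewrite linr mulrDl -scalerAl.
rewrite -mpolyXD /exponent_root !mono_linearX.
have dvdE : [forall i, (p %| mnm_add u (mnm_muln m p) i)%N] = [forall i, (p %| u i)%N].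
  by apply: eq_forallb => i; rewrite mnmDE mulmnE dvdn_addl // dvdn_mull.
rewrite dvdE; case: ifP => [/forallP p_u|_]; last by rewrite mul0r.
rewrite -mpolyXD; congr (X _); apply/mnmP => i.
by rewrite mnmDE !mnmE mulmnE divnDl // mulnK.
Qed.

Hypothesis hp : p \in [pchar K].

Lemma mpoly_pchar : p \in [pchar R].
Proof.
rewrite !inE (pcharf_prime hp) /= -scaler_nat.
by rewrite (pcharf0 hp) scale0r.
Qed.

Lemma exprpD f g : (f + g) ^+ p = f ^+ p + g ^+ p.
Proof.
by rewrite -!(pFrobenius_autE mpoly_pchar) rmorphD.
Qed.

(** [f ^+ p] is obtained from [map_mpoly F f], [F] the Frobenius of [K], by
    replacing each [x_i] with [x_i ^+ p]. *)
Lemma exponent_rootM g f :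
  exponent_root (g * f ^+ p) =
  exponent_root g * map_mpoly (pFrobenius_aut hp) f.
Proof.
have p_gt0 := prime_gt0 (pcharf_prime hp).
have linr := exponent_root_linear.
elim/mpolyind: f => [|c m f _ _ IHf].
  rewrite expr0n eqn0Ngt p_gt0 mulr0 raddf0 mulr0.
  exact: linear_fun0 linr.
rewrite exprpD exprZn mpolyXn mulrDr -scalerAr linr IHf exponent_rootMX // raddfD /= map_mpolyZ.
by rewrite map_mpolyX mulrDr -scalerAr.
Qed.

(** The part of the flatness of Frobenius that is used.  Applying
    [exponent_root] to an expression of [f ^+ p] by p-th powers of elements of
    [I] expresses [map_mpoly F f] by the [map_mpoly F a] with [a] in [I], where
    [F] is the Frobenius of [K]; it remains to descend from [K] to [F K]. *)
Lemma frobenius_power_reflect I f : is_ideal I ->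
  frobenius_power I p (f ^+ p) -> I f.
Proof.
move=> idI hf; apply: (extended_span_descent (F := pFrobenius_aut hp)) => //.
set W := extended_span _ _.
have [W0 WD WM] : is_ideal W by apply: extended_span_ideal.
have linr := exponent_root_linear.
(* The multiplier [h] turns this into a condition that defines an ideal. *)
have h : frobenius_power I p `<=` [set g | forall h, W (exponent_root (h * g))].
  apply: ideal_gen_min.
    split=> [h|x y hx hy h|a x hx h].
    - by rewrite mulr0 (linear_fun0 linr).
    - rewrite mulrDr -[h * x]scale1r linr scale1r.
      by apply: WD; [apply: hx|apply: hy].
    - by rewrite mulrA; apply: hx.
  move=> _ [x Ix <-] h; rewrite exponent_rootM; apply: WM.
  by exists [:: (1, x)]; rewrite ?big_seq1 ?scale1r // => y; rewrite inE => /eqP ->.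
have := h _ hf 1; rewrite exponent_rootM; congr (W _).
rewrite -mpolyX0 /exponent_root mono_linearX.
case: ifP => [_|/forallP []] => [|i]; last by rewrite mnm0E dvdn0.
rewrite -[RHS]mul1r -mpolyX0; congr (X _ * _).
by apply/mnmP => i; rewrite mnmE !mnm0E div0n.
Qed.

Lemma frobenius_power_reflectM J q f :
  frobenius_power J (q * p) (f ^+ p) -> frobenius_power J q f.
Proof.
move=> hf; apply: frobenius_power_reflect; first exact: ideal_gen_ideal.
apply: (ideal_gen_min _ _ hf); first exact: ideal_gen_ideal.
move=> _ [x Jx <-]; apply: ideal_gen_sub; exists (x ^+ q); last by rewrite exprM.
by apply: ideal_gen_sub; exists x.
Qed.

End FrobeniusDescent.

(** * Minimal primes of monomial ideals *)

Section CoordinatePrimes.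
Variables (K : fieldType) (d : nat).
Local Notation R := (mpoly d K).
Local Notation X := (mpolyX K).
Implicit Types (m : multinom d) (i : 'I_d) (f g h : R) (I P Q : set R).
Implicit Types (T : {set 'I_d}).

(** The ideal generated by the variables of index in [T], described by its
    monomials. *)
Definition coord_prime T : set R :=
  [set f | forall m, {in T, forall i, m i = 0%N} -> mcoeff m f = 0].

Definition kill_vars T : R -> R :=
  comp_mpoly [tuple (if i \in T then 0 else X (mnm1 i)) | i < d].

Lemma mcoeff_kill_vars T f m :
  mcoeff m (kill_vars T f) =
  if [forall i in T, m i == 0%N] then mcoeff m f else 0.
Proof.
rewrite /kill_vars; elim/mpolyind: f => [|c u f _ _ IHf].
  by rewrite comp_mpoly0 !mcoeff0 if_same.
rewrite comp_mpolyD comp_mpolyZ !mcoeffD !mcoeffZ IHf comp_mpolyX.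
have [/forallP uT|] := boolP [forall i in T, u i == 0%N].
  have -> : \prod_i tnth [tuple (if j \in T then 0 else X (mnm1 j)) | j < d] i ^+ u i =
      X u :> R.
    rewrite mpolyXE_id; apply: eq_bigr => i _; rewrite tnth_mktuple.
    case: ifP => // iT; have := uT i.
    by rewrite iT => /eqP ->; rewrite !expr0.
  rewrite mcoeffX; case: eqVneq => [<-|_].
    by case: ifP => // /forallP.
  by rewrite mulr0 !add0r.
rewrite negb_forall => /existsP [i]; rewrite negb_imply => /andP [iT ui_nz].
rewrite (bigD1 i) //= tnth_mktuple iT expr0n (negbTE ui_nz) mul0r mcoeff0.
rewrite mulr0 add0r; case: ifP => // /forallP mT; rewrite mcoeffX.
case: eqP => [eq_um|_]; last by rewrite mulr0 add0r.
by have := mT i; rewrite iT -eq_um (negbTE ui_nz).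
Qed.

Lemma coord_primeE T f : coord_prime T f <-> kill_vars T f = 0.
Proof.
split=> [hf|f0 m mT].
  apply/mpolyP => m; rewrite mcoeff_kill_vars mcoeff0; case: ifP => // /forallP h.
  by apply: hf => i iT; have := h i; rewrite iT => /eqP.
have := mcoeff_kill_vars T f m; rewrite f0 mcoeff0 ifT //.
by apply/forallP => i; apply/implyP => /mT ->.
Qed.

(** It is the kernel of an endomorphism of a domain. *)
Lemma coord_prime_prime T : is_prime_ideal (coord_prime T).
Proof.
split; first split.
- split=> [|x y|a x]; rewrite !coord_primeE /kill_vars ?raddf0 //.
    by rewrite raddfD /= => -> ->; rewrite addr0.
  by rewrite rmorphM /= => ->; rewrite mulr0.
- apply/eqP => eqT; have : coord_prime T 1 by rewrite eqT.
  move=> /(_ (@mnm0 d)) /=; rewrite mcoeff1 eqxx => h.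
  by have /eqP := h (fun i _ => mnm0E i); rewrite oner_eq0.
move=> x y; rewrite !coord_primeE /kill_vars rmorphM /= => /eqP.
by rewrite mulf_eq0 => /orP [] /eqP; [left|right].
Qed.

Lemma coord_primeX T m : coord_prime T (X m) <-> exists2 i, i \in T & m i != 0%N.
Proof.
split=> [hm|[i iT mi_nz] u uT].
  apply: contrapT => no_i; suff /eqP : mcoeff m (X m) = 0.
    by rewrite mcoeffX eqxx oner_eq0.
  apply: hm => i iT; apply/eqP; apply/negPn/negP => mi_nz.
  by apply: no_i; exists i.
rewrite mcoeffX; case: eqP => // eq_mu.
by rewrite eq_mu uT ?eqxx in mi_nz.
Qed.

Lemma prime_ideal_mono P m : is_prime_ideal P -> P (X m) ->
  exists2 i, m i != 0%N & P (X (mnm1 i)).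
Proof.
move=> primeP; have [[idP P_proper] PM] := primeP.
rewrite mpolyXE_id => hm; apply: contrapT => no_i.
suff : ~ P (\prod_i X (mnm1 i) ^+ m i) by [].
apply: (big_ind (fun f => ~ P f)) => [/(ideal1 idP) eqP|x y hx hy /PM []|i _] //.
  by rewrite eqP eqxx in P_proper.
move=> hi; apply: no_i; exists i; last exact: prime_idealX hi.
apply/eqP => mi0; move: hi; rewrite mi0 expr0 => /(ideal1 idP) eqP.
by rewrite eqP eqxx in P_proper.
Qed.

Definition vars_of P : {set 'I_d} := [set i | `[< P (X (mnm1 i)) >]]%SET.

Lemma coord_prime_vars P : is_ideal P -> coord_prime (vars_of P) `<=` P.
Proof.
move=> idP f hf; apply: mem_mono_ideal => // m; rewrite mcoeff_msupp => fm_nz.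
have [i iP mi_nz] : exists2 i, i \in vars_of P & m i != 0%N.
  apply: contrapT => no_i; case/eqP: fm_nz; apply: hf => i iP.
  by apply/eqP/negPn/negP => mi_nz; apply: no_i; exists i.
move: iP; rewrite inE => /asboolP Pi.
apply: (mono_mul_le idP Pi) => j; rewrite mnm1E.
by case: eqP => [<-|//]; rewrite lt0n.
Qed.

Lemma monomial_ideal_coord_prime I T : is_monomial_ideal I ->
  (forall m, I (X m) -> exists2 i, i \in T & m i != 0%N) -> I `<=` coord_prime T.
Proof.
move=> monI hI f If; apply: mem_mono_ideal.
  by have [[]] := coord_prime_prime T.
by move=> m m_f; apply/coord_primeX/hI/(monomial_ideal_msupp monI If).
Qed.

Lemma monomial_sub_vars I P : is_monomial_ideal I -> is_prime_ideal P ->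
  I `<=` P -> I `<=` coord_prime (vars_of P).
Proof.
move=> monI primeP IP; apply: monomial_ideal_coord_prime => // m /IP.
move=> /(prime_ideal_mono primeP) [i mi_nz Pi]; exists i => //.
by rewrite inE; apply/asboolP.
Qed.

(** A prime containing [I] contains the variables that it needs to do so. *)
Lemma minimal_primes_coord I P : is_monomial_ideal I ->
  minimal_primes I P -> P = coord_prime (vars_of P).
Proof.
move=> monI [primeP IP minP]; apply/esym/minP; first exact: coord_prime_prime.
  exact: monomial_sub_vars.
by apply: coord_prime_vars; case: primeP => -[].
Qed.

Lemma minimal_prime_exists I T : is_monomial_ideal I -> I `<=` coord_prime T ->
  exists2 T' : {set 'I_d}, T' \subset T & minimal_primes I (coord_prime T').
Proof.
move=> monI IT; pose cov T := `[< I `<=` coord_prime T >].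
have /minset_exists [T' minT' T'T] : cov T by apply/asboolP.
exists T' => //; have /minsetP [/asboolP IT' minI] := minT'.
split=> // [|Q primeQ IQ QT']; first exact: coord_prime_prime.
have IvQ : cov (vars_of Q) by apply/asboolP/monomial_sub_vars.
have eqT : vars_of Q = T'.
  apply: minI => //; apply/fintype.subsetP => i; rewrite inE => /asboolP /QT'.
  case/coord_primeX => j jT'; rewrite mnm1E.
  by case: (eqVneq i j) => [->|].
apply/seteqP; split=> //; rewrite -eqT; apply: coord_prime_vars.
by case: primeQ => -[].
Qed.

(** Adding the variables of [T] one by one gives a chain of primes. *)
Lemma height_coord_prime (F : realType) T :
  (#|T|%:R%:E <= height F (coord_prime T))%E.
Proof.
apply: ereal_sup_ubound; exists #|T| => //.
pose c k := coord_prime [set i in take k (enum T)]%SET.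
exists c; split=> [k _|k lt_kT|]; first exact: coord_prime_prime.
  have [x0 _] : exists x0, x0 \in T by apply/card_gt0P; apply: leq_ltn_trans lt_kT.
  rewrite cardE in lt_kT; split.
    move=> f hf m mT; apply: hf => i; rewrite inE => i_k; apply: mT.
    by rewrite inE (take_nth x0) // mem_rcons inE i_k orbT.
  move=> /(_ (X (mnm1 (nth x0 (enum T) k)))).
  have := enum_uniq T; rewrite -{1}(cat_take_drop k (enum T)) cat_uniq.
  rewrite (drop_nth x0) //= => /and3P [_ /norP [k_notin _] _] h.
  have /h /coord_primeX [i] : c k.+1 (X (mnm1 (nth x0 (enum T) k))).
    apply/coord_primeX; exists (nth x0 (enum T) k); last by rewrite mnm1E eqxx.
    by rewrite inE (take_nth x0) // mem_rcons inE eqxx.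
  rewrite inE mnm1E; case: (eqVneq (nth x0 _ k) i) => // <-.
  by rewrite (negbTE k_notin).
rewrite /c; congr coord_prime; apply/setP => i.
by rewrite inE cardE take_size mem_enum.
Qed.

End CoordinatePrimes.

(** * The threshold *)

Section Containment.
Variables (K : fieldType) (d : nat).
Local Notation R := (mpoly d K).
Local Notation X := (mpolyX K).
Implicit Types (I J : set R).

(** A monomial [x^m] outside [J^[q]] has [floor (m / q)] outside [J], so the
    variables with exponent below [q] in [m] generate a prime containing [I];
    differentiating away those of a minimal prime takes few derivatives. *)
Lemma diff_power_sub_frobenius I J h q t :
  is_monomial_ideal I -> is_radical_ideal J -> I `<=` J ->
  (forall T : {set 'I_d}, minimal_primes I (coord_prime T) -> #|T| <= h)%N ->
  (0 < q)%N -> (h * q.-1 < t)%N -> diff_power I t `<=` frobenius_power J q.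
Proof.
move=> monI [idJ radJ] IJ leh q_gt0 lt_t f hf.
have idJq : is_ideal (frobenius_power J q) by apply: ideal_gen_ideal.
apply: mem_mono_ideal => // m m_f.
pose u : multinom d := Multinom [tuple (m i %/ q)%N | i < d].
have uE i : u i = (m i %/ q)%N by rewrite mnmE.
have [Ju|nJu] := pselect (J (X u)).
  apply: (@mono_mul_le _ _ _ _ (mnm_muln u q)) => // [|i].
    by rewrite -mpolyXn; apply: ideal_gen_sub; exists (X u).
  by rewrite mulmnE uE leq_trunc_div.
(* The variables whose exponent in [m] is below [q]. *)
exfalso; pose T0 := [set i | u i == 0%N]%SET.
have IT0 : I `<=` coord_prime T0.
  apply: monomial_ideal_coord_prime => // g /IJ Jg; apply: contrapT => no_i.
  apply/nJu/(radJ _ (mdeg g)); rewrite mpolyXn.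
  apply: (mono_mul_le idJ Jg) => i; rewrite mulmnE.
  have le_g : (g i <= mdeg g)%N by rewrite mdegE (bigD1 i) //= leq_addr.
  have [gi0|gi_nz] := eqVneq (g i) 0%N; first by rewrite gi0.
  have ui_gt0 : (0 < u i)%N.
    rewrite lt0n; apply/negP => ui0; apply: no_i; exists i => //.
    by rewrite inE.
  by apply: leq_trans le_g _; rewrite leq_pmull.
have [T /fintype.subsetP TT0 minT] := minimal_prime_exists monI IT0.
(* The part of [m] in the variables of the minimal prime. *)
pose a : multinom d := Multinom [tuple (if i \in T then m i else 0)%N | i < d].
have aE i : a i = if i \in T then m i else 0%N by rewrite mnmE.
have deg_a : (mdeg a < t)%N.
  apply: leq_ltn_trans lt_t; rewrite mdegE.
  apply: (@leq_trans (\sum_(i in T) q.-1)); last first.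
    by rewrite sum_nat_const leq_mul2r leh ?orbT.
  rewrite [leqRHS]big_mkcond; apply: leq_sum => i _; rewrite aE.
  case: ifP => // /TT0; rewrite inE uE -leqn0 leqNgt divn_gt0 // -ltnNge.
  by move=> lt_mq; rewrite -ltnS prednK.
have bin_a : multibin m a = 1%N.
  by rewrite /multibin big1 // => i _; rewrite aE; case: ifP; rewrite ?binn ?bin0.
have Ia : I (X (mnm_sub m a)).
  by apply: (diff_power_mono monI hf m_f deg_a); rewrite bin_a oner_eq0.
have [_ IT _] := minT; have /coord_primeX [i iT] := IT _ Ia.
by rewrite mnmBE aE iT subnn.
Qed.

End Containment.

Section Thresholds.
Variables (F : realType) (A : comNzRingType) (p : nat).
Variables (J : set A) (a : nat -> set A).
Implicit Types (e t h : nat).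

Lemma F_nu_max e n : ~ (a n `<=` frobenius_power J (p ^ e)) ->
  (forall t, ~ (a t `<=` frobenius_power J (p ^ e)) -> (t <= n)%N) ->
  F_nu F p J a e = n%:R%:E.
Proof.
move=> an max_n; apply/eqP; rewrite eq_le; apply/andP; split.
  by apply: ge_ereal_sup => _ [t /max_n le_tn <-]; rewrite lee_fin ler_nat.
by apply: ereal_sup_ubound; exists n.
Qed.

(** The last hypothesis makes the ratios nondecreasing in [e], and the second
    bounds them by [h]. *)
Lemma F_threshold_exists h : (0 < p)%N ->
  (forall e, ~ (a 0 `<=` frobenius_power J (p ^ e))) ->
  (forall e t, ~ (a t `<=` frobenius_power J (p ^ e)) -> (t <= h * p ^ e)%N) ->
  (forall e t, ~ (a t `<=` frobenius_power J (p ^ e)) ->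
     ~ (a (p * t)%N `<=` frobenius_power J (p ^ e.+1))) ->
  exists2 c : F, is_F_threshold p J a c & c <= h%:R.
Proof.
move=> p_gt0 ha0 bound_a step_a.
have ex_max e : exists n, ~ (a n `<=` frobenius_power J (p ^ e)) /\
    forall t, ~ (a t `<=` frobenius_power J (p ^ e)) -> (t <= n)%N.
  pose P t := `[< ~ (a t `<=` frobenius_power J (p ^ e)) >].
  have exP : exists t, P t by exists 0%N; apply/asboolP.
  have boundP t : P t -> (t <= h * p ^ e)%N by move=> /asboolP /bound_a.
  have [n /asboolP an max_n] := ex_maxnP exP boundP.
  by exists n; split=> // t at_; apply/max_n/asboolP.
have [N /all_and2 [aN maxN]] := choice ex_max.
pose r e : F := (N e)%:R / (p ^ e)%:R.
have pe_gt0 e : 0 < (p ^ e)%:R :> F by rewrite ltr0n expn_gt0 p_gt0.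
have ratioE : F_nu_ratio F p J a = EFin \o r.
  by apply: funext => e; rewrite /F_nu_ratio (F_nu_max (aN e) (@maxN e)).
have r_le e : r e <= h%:R.
  by rewrite ler_pdivrMr // -natrM ler_nat; apply: bound_a.
have r_ge0 e : 0 <= r e by rewrite divr_ge0.
have r_nondecr : nondecreasing_seq r.
  apply/nondecreasing_seqP => e; rewrite /r expnS natrM invfM mulrA.
  rewrite ler_pM2r ?invr_gt0 // ler_pdivlMr ?ltr0n // -natrM ler_nat mulnC.
  exact/maxN/step_a.
have r_cvg : cvgn r.
  by apply: nondecreasing_is_cvgn => //; exists h%:R => _ [e _ <-].
have ratio_cvg : F_nu_ratio F p J a @ \oo --> (limn r)%:E.
  by rewrite ratioE; apply: cvg_EFin; [apply: nearW|].
exists (limn r); last by apply: limr_le => //; apply: nearW.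
split; first by apply: limr_ge => //; apply: nearW.
- by rewrite /upper_F_threshold (cvg_limn_einf_sup ratio_cvg).2.
- by rewrite /lower_F_threshold (cvg_limn_einf_sup ratio_cvg).1.
Qed.

End Thresholds.

Theorem theorem1 (R : realType) (K : fieldType) (p : nat)
    (hp : p \in [pchar K]) (d : nat) (I J : set (mpoly d K))
    (hI : is_proper_ideal I) (hI0 : I != [set 0])
    (hJ : is_proper_ideal J) (hJ0 : J != [set 0])
    (hIJ : I `<=` J) (hImon : is_monomial_ideal I) (hJrad : is_radical_ideal J) :
  exists c : R,
    is_F_threshold p J (diff_power I) c /\
    exists2 h : \bar R,
      is_max [set height R P | P in minimal_primes I] h & (c%:E <= h)%E.
Proof.
have p_gt0 := prime_gt0 (pcharf_prime hp).
have [idI I_proper] := hI; have [idJ J_proper] := hJ.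
pose P (T : {set 'I_d}) := `[< minimal_primes I (coord_prime T) >].
have [T1 PT1] : exists T1, P T1.
  have IT : I `<=` coord_prime [set: 'I_d]%SET.
    apply: monomial_ideal_coord_prime => // m Im; apply: contrapT => no_i.
    have m0 : m = @mnm0 d.
      apply/mnmP => i; rewrite mnm0E; apply/eqP/negPn/negP => mi_nz.
      by apply: no_i; exists i.
    move: Im; rewrite m0 mpolyX0 => /(ideal1 idI) eqI.
    by rewrite eqI eqxx in I_proper.
  by have [T1 _ minT1] := minimal_prime_exists hImon IT; exists T1; apply/asboolP.
(* [T2] has the most variables and bounds the threshold, [T3] has the largest
   height; #|T2| <= ht(T2) <= ht(T3). *)
pose T2 := [arg max_(T > T1 | P T) #|T|].
have [PT2 max_T2] : P T2 /\ forall T, P T -> (#|T| <= #|T2|)%N.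
  by rewrite /T2; case: arg_maxnP.
pose T3 := [arg max_(T > T1 | P T) height R (@coord_prime K d T)]%O.
have [PT3 max_T3] : P T3 /\ forall T, P T ->
    (height R (@coord_prime K d T) <= height R (@coord_prime K d T3))%E.
  by rewrite /T3; case: Order.TotalTheory.arg_maxP.
have leh (T : {set 'I_d}) : minimal_primes I (coord_prime T) -> (#|T| <= #|T2|)%N.
  by move=> minT; apply/max_T2/asboolP.
have [|e t nsub|e t|c c_threshold le_c] :=
    @F_threshold_exists R _ p J (diff_power I) #|T2| p_gt0.
- move=> e sub; have : frobenius_power J (p ^ e) 1 by apply: sub.
  move=> /ideal_gen_min -/(_ J idJ) J1.
  have /(ideal1 idJ) eqJ : J 1.
    apply: J1 => _ [x Jx <-]; rewrite -(prednK (_ : 0 < p ^ e)%N) ?expn_gt0 ?p_gt0 //.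
    by rewrite exprSr; case: idJ => _ _; apply.
  by rewrite eqJ eqxx in J_proper.
- rewrite leqNgt; apply/negP => lt_t; apply: nsub.
  apply: (diff_power_sub_frobenius hImon hJrad hIJ leh).
    by rewrite expn_gt0 p_gt0.
  by apply: leq_ltn_trans lt_t; rewrite leq_mul2l leq_pred orbT.
- move=> nsub sub; apply: nsub => f hf.
  apply: mem_mono_ideal; first exact: ideal_gen_ideal.
  move=> m m_f; apply: (frobenius_power_reflectM hp).
  rewrite -expnSr mpolyXn; apply: sub.
  exact: diff_power_frobenius hf m_f.
exists c; split=> //; exists (height R (@coord_prime K d T3)).
  split; first by exists (coord_prime T3) => //; apply/asboolP.
  move=> _ [Q minQ <-]; have eqQ := minimal_primes_coord hImon minQ.
  by rewrite eqQ; apply: max_T3; apply/asboolP; rewrite -eqQ.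
apply: le_trans (max_T3 _ PT2); apply: le_trans (height_coord_prime K R T2).
by rewrite lee_fin.
Qed.
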